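(* Let $S=(S,\le)$ be a partially ordered Polish space in which a subset is compact if and only if it is closed and order bounded. Then a set $\Lambda\subset\mathcal P(S)$ is tight if and only if $\Lambda$ is order bounded in $(\mathcal P(S),\preceq_{\mathrm{sd}})$.
   Context: A partially ordered Polish space is a separable, completely metrizable topological space $S$ with a closed partial order $\le$ (that is, $x_i\le y_i$, $x_i\to x$, $y_i\to y$ imply $x\le y$). A subset of a partially ordered set is order bounded if it is contained in an order interval $[a,b]=\{x:a\le x\le b\}$ with $a\le b$. $\mathcal P(S)$ is the set of Borel probability measures on $S$; $ibS$ is the set of bounded Borel measurable increasing functions $h:S\to\mathbb R$ ($x\le y$ implies $h(x)\le h(y)$); $\phi(h)=\int h\,d\phi$. Stochastic dominance: $\phi\preceq_{\mathrm{sd}}\psi$ iff $\phi(h)\le\psi(h)$ for all $h\in ibS$; this is a partial order on $\mathcal P(S)$. A set $\Lambda\subset\mathcal P(S)$ is tight if for all $\epsilon>0$ there is a compact $K\subset S$ with $\phi(K^c)\le\epsilon$ for all $\phi\in\Lambda$. *)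

(* Defs.v *)
From HB Require Import structures.
From mathcomp Require Import all_boot all_order all_algebra.
From mathcomp Require Import all_classical all_reals all_analysis.

Set Implicit Arguments.
Unset Strict Implicit.
Unset Printing Implicit Defensive.

Import Order.TTheory GRing.Theory Num.Theory.
Import numFieldNormedType.Exports.

Local Open Scope classical_set_scope.
Local Open Scope ring_scope.

Definition separable (T : topologicalType) : Prop :=
  exists2 D : set T, countable D & dense D.

Record is_metric (R : realType) (T : Type) (dist : T -> T -> R) : Prop := {
  dist_ge0 : forall x y, 0 <= dist x y ;
  dist_eq0 : forall x y, dist x y = 0 <-> x = y ;
  dist_sym : forall x y, dist x y = dist y x ;
  dist_triangle : forall x y z, dist x z <= dist x y + dist y z
}.

Definition metrizes (R : realType) (T : topologicalType) (dist : T -> T -> R) :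
    Prop :=
  forall x : T, nbhs x = nbhs_ball_ (fun x e => [set y | dist x y < e]) x.

Definition cauchy_seq_for (R : realType) (T : Type) (dist : T -> T -> R)
    (u : nat -> T) : Prop :=
  forall e : R, 0 < e ->
  exists N : nat, forall m n : nat,
    (N <= m)%N -> (N <= n)%N -> dist (u m) (u n) < e.

Definition completely_metrizable (R : realType) (T : topologicalType) : Prop :=
  exists dist : T -> T -> R,
    [/\ is_metric dist,
        metrizes dist &
        forall u : nat -> T, cauchy_seq_for dist u ->
          exists l : T, u @ \oo --> l].

(* The library's joint structure of topology and partial order imposes no
   compatibility between the two; it is imposed here by
   [closed_partial_order]. *)
Definition closed_partial_order (d : Order.disp_t)
    (S : POrderedPointedTopological.type d) : Prop :=
  forall (u v : nat -> S) (x y : S),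
    (forall i, (u i <= v i)%O) -> u @ \oo --> x -> v @ \oo --> y -> (x <= y)%O.

Record partially_ordered_polish (R : realType) (d : Order.disp_t)
    (S : POrderedPointedTopological.type d) : Prop := {
  polish_separable : separable S ;
  polish_completely_metrizable : completely_metrizable R S ;
  polish_closed_order : closed_partial_order S
}.

Definition order_interval (T : Type) (le : T -> T -> Prop) (a b : T) : set T :=
  [set x | le a x /\ le x b].

Definition order_bounded (T : Type) (le : T -> T -> Prop) (A : set T) : Prop :=
  exists a b : T, le a b /\ A `<=` order_interval le a b.

(* [measurableType]s are pointed in MathComp-Analysis, hence the restriction to
   pointed spaces. *)
Definition borel (S : ptopologicalType) := g_sigma_algebraType (@open S).

Definition ib (R : realType) (d : Order.disp_t)
    (S : POrderedPointedTopological.type d) : set (S -> R) :=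
  [set h | [/\ bounded_fun h,
               measurable_fun [set: borel S] (h : borel S -> R) &
               forall x y : S, (x <= y)%O -> h x <= h y]].

Definition sd_le (R : realType) (d : Order.disp_t)
    (S : POrderedPointedTopological.type d)
    (phi psi : probability (borel S) R) : Prop :=
  forall h : S -> R, @ib R d S h -> \int[phi]_x h x <= \int[psi]_x h x.

Definition tight (R : realType) (S : ptopologicalType)
    (L : set (probability (borel S) R)) : Prop :=
  forall e : R, 0 < e ->
  exists2 K : set S, compact K &
    forall phi, L phi -> (phi (~` K) <= e%:E)%E.

(* Main.v *)
Require Import Defs.
From HB Require Import structures.
From mathcomp Require Import all_boot all_order all_algebra.
From mathcomp Require Import all_classical all_reals all_analysis.
From mathcomp Require Import measurable_realfun.
Import Order.TTheory GRing.Theory Num.Theory.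
Import numFieldNormedType.Exports.
Local Open Scope classical_set_scope.
Local Open Scope ring_scope.

(** Stochastic dominance only has to be tested on Borel up-sets
    ([sd_le_upset]): the indicator of an up-set is increasing, and conversely
    the integral of an increasing function is recovered from the measures of
    its superlevel sets, which are up-sets.

    If [L] lies between [mu] and [nu], then each of these two single measures
    is tight by Ulam's theorem ([ulam]), so [mu] almost lives on a compact
    set, which has a lower bound [a], and [nu] almost lives on a compact set,
    which has an upper bound [b]. The points above [a] form an up-set, and so
    do the points that are not below [b]; dominance therefore transports the
    two estimates to every [phi] in [L], and the interval from [a] to [b],
    compact by hypothesis, carries almost all of [phi].

    If [L] is tight, choose compact sets [K n] whose complements have measure
    at most [2 ^- n.+1] under every member of [L]. Finite sets are compact,
    hence order bounded, so the order is directed both ways, and the [K n] can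
    be enclosed in intervals from [a n] to [b n] with [a] decreasing and [b]
    increasing ([exhausting_intervals]). The upper bound of [L] is the law of
    [b N], where [N] is geometric: [N = n] with probability [2 ^- n.+1]. The
    lower bound is the law of [a N]. Indeed, for an up-set [U], let [n] be the
    first index with [b n] in [U]. Then [U] misses [K m] for every [m < n], so
    [phi U <= 2 ^- n], and [2 ^- n] is exactly the probability that [N >= n],
    that is, that [b N] is in [U]; without such an [n], [U] misses every [K m]
    and is null. Applied to complements of up-sets, the same
    argument gives the lower bound ([geom_mix_dominates]). *)

(** * Compactness in complete metric spaces *)

Section MetrizableSpaces.
Context (R : realType) (T : topologicalType) (dist : T -> T -> R).
Hypotheses (distP : is_metric dist) (metT : metrizes dist).

Let cball (x : T) (e : R) : set T := [set y | dist x y <= e].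

Lemma nbhs_metricP (x : T) (A : set T) :
  nbhs x A <-> exists2 e : R, 0 < e & [set y | dist x y < e] `<=` A.
Proof. by rewrite metT. Qed.

Lemma seq_closed_closed (A : set T) :
  (forall (u : nat -> T) x, (forall n, A (u n)) -> u @ \oo --> x -> A x) ->
  closed A.
Proof.
move=> seqA x clAx.
have /choice [u uP] (n : nat) : exists y, A y /\ dist x y < n.+1%:R^-1.
  have [|y [Ay xy]] := clAx [set y | dist x y < n.+1%:R^-1]; last by exists y.
  by apply/nbhs_metricP; exists n.+1%:R^-1 => //; rewrite invr_gt0 ltr0n.
apply: (seqA u) => [n|]; first by have [] := uP n.
move=> B /nbhs_metricP [e e0 eB].
have := near_infty_natSinv_lt (PosNum e0).
apply: filterS => n /= ne; apply: eB => /=.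
by have [_ /lt_trans] := uP n; apply.
Qed.

Lemma closed_cball (x : T) (e : R) : closed (cball x e).
Proof.
move=> y cly /=; apply/ler_addgt0Pr => r r0.
have [|z [/= xz yz]] := cly [set z | dist y z < r].
  by apply/nbhs_metricP; exists r.
rewrite (le_trans (dist_triangle distP x z y))// lerD// (dist_sym distP).
exact: ltW.
Qed.

Lemma ultra_bigsetU (F : set_system T) (B : nat -> set T) (n : nat) :
  UltraFilter F -> F (\big[setU/set0]_(i < n) B i) -> exists i, F (B i).
Proof.
move=> FU; elim: n => [|n IH].
  by rewrite big_ord0 => /filter_not_empty.
rewrite big_ord_recr /= => FBU.
have [FB|FBC] := in_ultra_setVsetC (B n) FU; first by exists n.
apply: IH; apply: filterS (filterI FBU FBC).
by move=> z [[]].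
Qed.

(** In each of the finite covers an ultrafilter [F] on the set selects one ball.
    Selected balls meet pairwise, so their centres form a Cauchy sequence; its
    limit is the limit of [F], and lies in every selected ball because these
    balls are closed. *)
Lemma compact_totally_bounded (x : nat -> T) (N : nat -> nat) :
  (forall u, cauchy_seq_for dist u -> exists l : T, u @ \oo --> l) ->
  compact (\bigcap_k \big[setU/set0]_(i < N k) cball (x i) k.+1%:R^-1).
Proof.
move=> cplt; set K := \bigcap_k _.
rewrite compact_ultra => F FU FK.
have /choice [i iP] (k : nat) :
    exists i, (i < N k)%N /\ F (cball (x i) k.+1%:R^-1).
  have FKk : F (\big[setU/set0]_(i < N k) cball (x i) k.+1%:R^-1).
    by apply: filterS FK => z /(_ k I).
  (* [ultra_bigsetU] forgets the bound on the index; emptying the balls beyond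
     [N k] restores it. *)
  pose B j := if (j < N k)%N then cball (x j) k.+1%:R^-1 else set0.
  have [|j] := @ultra_bigsetU F B (N k) FU.
    by move: FKk; congr F; apply: eq_bigr => j _; rewrite /B ltn_ord.
  rewrite /B; case: ifPn => [jN FB|_ /filter_not_empty//]; exists j; split=> //.
pose u k := x (i k).
have Fu k : F (cball (u k) k.+1%:R^-1) by have [] := iP k.
have natS_le (m n : nat) : (m <= n)%N -> n.+1%:R^-1 <= m.+1%:R^-1 :> R.
  by move=> mn; rewrite lef_pV2 ?posrE ?ltr0n// ler_nat.
have distu m n : dist (u m) (u n) <= m.+1%:R^-1 + n.+1%:R^-1.
  have [z [/= mz nz]] := filter_ex (filterI (Fu m) (Fu n)).
  rewrite (le_trans (dist_triangle distP _ z _))// lerD//.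
  by rewrite (dist_sym distP).
have small (e : R) : 0 < e -> exists n : nat, n.+1%:R^-1 < e.
  move=> e0; have [n _ /(_ n (leqnn n)) /= ne] :=
    near_infty_natSinv_lt (PosNum e0).
  by exists n.
have [|l ul] := cplt u.
  move=> e e0; have [M Me] := small (e / 2) (divr_gt0 e0 (ltr0Sn R 1)).
  exists M => m n Mm Mn; apply: le_lt_trans (distu m n) _.
  by rewrite (splitr e) ltrD// (le_lt_trans _ Me)// natS_le.
have Fl : F --> l.
  move=> A /nbhs_metricP [e e0 eA].
  have [M Me] := small (e / 2) (divr_gt0 e0 (ltr0Sn R 1)).
  have : nbhs l [set y | dist l y < e / 2].
    by apply/nbhs_metricP; exists (e / 2) => //; rewrite divr_gt0.
  move=> /ul [M' _ M'P].
  pose n := maxn M M'.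
  apply: filterS (Fu n) => z /= nz; apply: eA => /=.
  rewrite (le_lt_trans (dist_triangle distP _ (u n) _))// (splitr e).
  rewrite ltrD//; first by apply: M'P; rewrite /= leq_maxr.
  by rewrite (le_lt_trans nz)// (le_lt_trans _ Me)// natS_le// leq_maxl.
exists l; split=> // k _.
have [ik _] := iP k.
rewrite (bigD1 (Ordinal ik)) //=; left.
apply: (closed_cball (u k) k.+1%:R^-1) => B Bl.
have [z [zk zB]] := filter_ex (filterI (Fu k) (Fl _ Bl)).
by exists z.
Qed.

End MetrizableSpaces.

(** * Stochastic dominance in terms of up-sets *)

Lemma le_probability_setC d (T : measurableType d) (R : realType)
    (P Q : probability T R) (A : set T) :
  measurable A -> (P (~` A) <= Q (~` A))%E = (Q A <= P A)%E.
Proof.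
move=> mA; rewrite !probability_setC//.
rewrite -(fineK (fin_num_measure P _ mA)) -(fineK (fin_num_measure Q _ mA)).
by rewrite -!EFinB !lee_fin lerD2l lerN2.
Qed.

(** The expectation of a nonnegative variable is the integral of its tail
    probabilities. *)
Lemma ge0_le_expectation_ccdf d (T : measurableType d) (R : realType)
    (P Q : probability T R) (X : {mfun T >-> R}) :
  (forall x, 0 <= X x) ->
  (forall r, (P [set x | (r < X x)%R] <= Q [set x | (r < X x)%R])%E) ->
  (\int[P]_x (X x)%:E <= \int[Q]_x (X x)%:E)%E.
Proof.
move=> X0 PQ.
rewrite -(@expectation_def _ _ _ P X) -(@expectation_def _ _ _ Q X).
rewrite !ge0_expectation_ccdf//.
have mP : measurable_fun setT (fun r : R => @ccdf _ _ _ P X r).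
  exact: ccdf_measurable.
have mQ : measurable_fun setT (fun r : R => @ccdf _ _ _ Q X r).
  exact: ccdf_measurable.
apply: ge0_le_integral => //; [exact: measurable_funTS..|] => r _.
by rewrite /ccdf set_itvoy; exact: PQ.
Qed.

Definition upset {d} {S : porderType d} (U : set S) : Prop :=
  forall x y : S, (x <= y)%O -> U x -> U y.

(** For the converse, a bounded increasing function is shifted by a constant to
    make it nonnegative; its superlevel sets are up-sets, so the comparison of
    tails applies. *)
Lemma sd_le_upset (R : realType) d (S : POrderedPointedTopological.type d)
    (phi psi : probability (borel S) R) :
  sd_le phi psi <->
  forall U : set (borel S), measurable U -> upset (U : set S) ->
    (phi U <= psi U)%E.
Proof.
split=> [sd U mU upU|sdU h [bh mh homo_h]].
  have ibU : @ib R d S (\1_U : S -> R).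
    split.
    - exists 1; split=> // M /ltW M1 x _ /=; rewrite indicE ger0_norm//.
      by rewrite (le_trans _ M1)// lern1 leq_b1.
    - exact: measurable_indic.
    - move=> x y xy; rewrite !indicE ler_nat.
      case: (boolP (x \in U)) => //; rewrite inE => Ux.
      by rewrite mem_set//; exact: upU Ux.
  have := sd _ ibU; rewrite /Rintegral !integral_indic// !setIT.
  by rewrite -lee_fin !fineK ?fin_num_measure.
have [M hM] : exists M : R, forall x, `|h x| <= M.
  have [M [_ hM]] := bh; exists (M + 1) => x; apply: hM => //.
  by rewrite ltrDl.
pose g : borel S -> R := fun x => h x + M.
have mg : measurable_fun [set: borel S] g by exact: measurable_funD.
have g0 x : 0 <= g x.
  by rewrite /g -lerBlDr sub0r; have := hM x; rewrite ler_norml => /andP[].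
have bg : [bounded g x | x in [set: borel S]].
  exists (M + M); split=> [|N /ltW MN x _ /=]; first exact: num_real.
  rewrite ger0_norm// (le_trans _ MN)// /g lerD2r.
  by have := hM x; rewrite ler_norml => /andP[].
have int_bounded (mu : probability (borel S) R) (f : borel S -> R) :
    measurable_fun setT f -> [bounded f x | x in [set: borel S]] ->
    mu.-integrable setT (EFin \o f).
  move=> mf bf; apply: measurable_bounded_integrable => //.
  by rewrite (le_lt_trans (probability_le1 _ _))// ltry.
have Rint_g (mu : probability (borel S) R) :
    \int[mu]_x g x = \int[mu]_x h x + M.
  rewrite RintegralD ?int_bounded//.
  - by rewrite Rintegral_cst// [X in _ * fine X](@probability_setT _ _ _ mu) /= mulr1.
  - exists `|M|; split=> [|N /ltW MN x _ //]; exact: num_real.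
rewrite -(lerD2r M) -!Rint_g.
have Efin (mu : probability (borel S) R) :
    (\int[mu]_x (g x)%:E)%E \is a fin_num.
  exact: integrable_fin_num (int_bounded _ _ mg bg).
rewrite /Rintegral fine_le ?Efin//.
pose gm := isMeasurableFun.Build _ _ (borel S) R g mg.
pose G : {mfun borel S >-> R} := HB.pack g gm.
apply: (@ge0_le_expectation_ccdf _ _ _ phi psi G) => // r; apply: sdU.
  rewrite -[X in measurable X]setTI.
  apply: (mg measurableT [set y | r < y]); rewrite -set_itvoy.
  exact: measurable_itv.
move=> x y xy /=; rewrite /g => rx.
by rewrite (lt_le_trans rx)// lerD2r homo_h.
Qed.

(** * Geometric mixtures of point masses *)

Section GeometricMixture.
Context (R : realType) d (T : measurableType d) (c : nat -> T).

Let weight (n : nat) : {nonneg R} := (2 ^- n.+1)%:nng.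

(** The law of [c N] for a random index [N] that is geometric on the natural
    numbers: [N = n] with probability [2 ^- n.+1]. *)
Definition geom_mix : set T -> \bar R :=
  mseries (fun n => mscale (weight n) \d_(c n)) 0.

HB.instance Definition _ := Measure.on geom_mix.

Lemma geom_mixE (A : set T) :
  geom_mix A = (\sum_(0 <= n <oo) (2 ^- n.+1 * (c n \in A)%:R)%:E)%E.
Proof.
by apply: eq_eseriesr => n _; rewrite EFinM.
Qed.

Lemma geom_tail (n : nat) :
  (\sum_(n <= k <oo) (2 ^- k.+1)%:E = (2 ^- n : R)%:E)%E.
Proof.
rewrite -nneseries_addn; last first.
  by move=> k; rewrite lee_fin.
have /cvg_lim := @cvg_geometric_eseries_half R 1 n.
rewrite div1r => <- //.
by apply: eq_eseriesr => k _; rewrite div1r natrX addnS.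
Qed.

Lemma geom_mix_tail (A : set T) (n : nat) :
  (forall k, (n <= k)%N -> A (c k)) -> ((2 ^- n : R)%:E <= geom_mix A)%E.
Proof.
move=> Ac; rewrite geom_mixE -geom_tail.
rewrite (nneseries_split 0 n); last by move=> k _; rewrite lee_fin mulr_ge0.
rewrite add0n; apply: le_trans (leeDr _ _); last first.
  by apply: sume_ge0 => k _; rewrite lee_fin mulr_ge0.
rewrite -[leLHS]nneseries_addn; last by move=> k; rewrite lee_fin.
rewrite -[leRHS]nneseries_addn; last by move=> k; rewrite lee_fin mulr_ge0.
apply: lee_nneseries => [k _ _|k _]; rewrite lee_fin //.
by rewrite mem_set ?mulr1//; apply: Ac; rewrite leq_addl.
Qed.

Lemma geom_mix_setT : geom_mix setT = 1%E.
Proof.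
rewrite geom_mixE; under eq_eseriesr do rewrite in_setT mulr1.
by rewrite geom_tail expr0 invr1.
Qed.

HB.instance Definition _ :=
  Measure_isProbability.Build _ _ _ geom_mix geom_mix_setT.

(** Let [n] be the first index with [c n] in [A]. If [n > 0], the first condition on
    [A] puts it outside [K n.-1], so [P A <= 2 ^- n]; by the second, [c k] is in
    [A] for all [k >= n], an event of probability [2 ^- n] for the mixture. If
    there is no such [n], then [A] lies outside every [K n] and is [P]-null.
    The hypotheses only mention [A] through [c], so the lemma serves up-sets
    and their complements alike. *)
Lemma geom_mix_dominates (P : probability T R) (A : set T) (K : nat -> set T) :
  measurable A -> (forall n, measurable (K n)) ->
  (forall n, (P (~` K n) <= (2 ^- n.+1)%:E)%E) ->
  (forall n, ~ A (c n) -> A `<=` ~` K n) ->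
  (forall n, A (c n) -> A (c n.+1)) ->
  (P A <= geom_mix A)%E.
Proof.
move=> mA mK PK AK Ac.
have P_small n : ~ A (c n) -> (P A <= (2 ^- n.+1)%:E)%E.
  move=> /AK sub; apply: le_trans (PK n).
  by apply: le_measure; rewrite ?inE//; exact: measurableC.
have [exA|nA] := pselect (exists n, `[< A (c n) >]).
  case: (ex_minnP exA) => n /asboolP An nmin.
  apply: (@le_trans _ _ (2 ^- n)%:E); last first.
    apply: geom_mix_tail => k /subnK <-.
    by elim: (k - n)%N => // m IH; rewrite addSn; exact: Ac.
  case: n An nmin => [_ _|n An nmin].
    by rewrite expr0 invr1; exact: probability_le1.
  apply: P_small => /asboolP /nmin; by rewrite ltnn.
apply: (@le_trans _ _ 0%E) => //.
apply/lee_addgt0Pr => e e0; rewrite add0e.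
have [n _ /(_ n (leqnn n)) /= ne] := near_infty_natSinv_expn_lt (PosNum e0).
apply: le_trans (P_small n _) _.
  by move=> An; apply: nA; exists n; apply/asboolP.
rewrite lee_fin ltW// (le_lt_trans _ ne)// div1r lef_pV2 ?posrE ?exprn_gt0//.
by rewrite ler_weXn2l// ler1n.
Qed.

End GeometricMixture.

(** * Ulam's theorem *)

Lemma open_borel (S : ptopologicalType) (A : set S) :
  open A -> measurable (A : set (borel S)).
Proof. by move=> oA; exact: sub_sigma_algebra. Qed.

Lemma closed_borel (S : ptopologicalType) (A : set S) :
  closed A -> measurable (A : set (borel S)).
Proof.
move=> cA; rewrite -[A]setCK; apply: measurableC.
by apply: open_borel; rewrite openC.
Qed.

Lemma dense_seq (T : ptopologicalType) :
  separable T -> exists x : nat -> T, forall A : set T,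
    open A -> A !=set0 -> exists n, A (x n).
Proof.
move=> [D cD dD].
have /pfcard_geP [D0|[x]] := cD.
  have [|z [_]] := dD setT _ openT; first by exists point.
  by rewrite D0.
exists x => A oA A0; have [z [Az Dz]] := dD A A0 oA.
by have [n _ xz] := 'oinvP_x Dz; exists n; rewrite xz.
Qed.

(** Continuity from above along the complements of the partial unions. *)
Lemma exists_prob_setC_bigsetU_le (R : realType) d (T : measurableType d)
    (P : probability T R) (B : nat -> set T) (e : R) :
  0 < e -> (forall i, measurable (B i)) -> \bigcup_i B i = setT ->
  exists n, (P (~` \big[setU/set0]_(i < n) B i) <= e%:E)%E.
Proof.
move=> e0 mB covB; pose C n := ~` \big[setU/set0]_(i < n) B i.
have C0 : \bigcap_n C n = set0.
  rewrite -setC_bigcup -[RHS]setCT; congr (~` _).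
  rewrite -covB; apply/seteqP; split=> z [n _].
    exact: bigsetU_bigcup.
  by move=> Bz; exists n.+1 => //; rewrite big_ord_recr /=; right.
have mC n : measurable (C n).
  by apply: measurableC; exact: bigsetU_measurable.
have : (P \o C) n @[n --> \oo] --> 0%E.
  rewrite -[X in _ --> X](measure0 P) -C0; apply: nonincreasing_cvg_mu => //.
  - by rewrite (le_lt_trans (probability_le1 _ _))// ltry.
  - exact: bigcap_measurable.
  - move=> m n mn; apply/subsetPset/subsetC.
    exact: subset_bigsetU.
move=> PC0; have cvg0 := fine_cvg PC0.
have [n _ /(_ n (leqnn n)) /= ne] := cvgr_lt _ (cvg0 _) _ e0.
by exists n; rewrite -(fineK (fin_num_measure P _ (mC n))) lee_fin ltW.
Qed.

(** Given [k], finitely many balls of radius [1 / k.+1] around points of a dense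
    sequence cover the space up to measure [e / 2 ^ k.+1]. The points covered
    for all [k] form a totally bounded closed set, hence a compact one, and the
    exceptional measures add up to at most [e]. *)
Lemma ulam (R : realType) (S : ptopologicalType)
    (phi : probability (borel S) R) :
  separable S -> completely_metrizable R S -> tight [set phi].
Proof.
move=> /dense_seq [x xD] [dist [distP metS cplt]] e e0.
pose B k i : set S := [set y | dist (x i) y <= k.+1%:R^-1].
have mB k i : measurable (B k i : set (borel S)).
  by apply: closed_borel; exact: closed_cball.
have covB k : \bigcup_i B k i = setT.
  rewrite -subTset => y _.
  have k0 : 0 < k.+1%:R^-1 :> R by rewrite invr_gt0.
  have ny : nbhs y [set z | dist y z < k.+1%:R^-1].
    by apply/(nbhs_metricP _ _ _ metS); exists k.+1%:R^-1.
  have [|n /interior_subset /= yn] :=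
      xD _ (@open_interior _ [set z | dist y z < k.+1%:R^-1]).
    by exists y.
  by exists n => //=; rewrite /B /= (dist_sym distP) ltW.
have /choice [N NP] (k : nat) : exists n,
    (phi (~` \big[setU/set0]_(i < n) B k i) <= (e / (2 ^ k.+1)%:R)%:E)%E.
  apply: exists_prob_setC_bigsetU_le => //.
  by rewrite divr_gt0// ltr0n expn_gt0.
exists (\bigcap_k \big[setU/set0]_(i < N k) B k i).
  exact: (compact_totally_bounded _ _ _ distP metS).
move=> _ ->; rewrite setC_bigcap.
pose C k : set S := ~` \big[setU/set0]_(i < N k) B k i.
have mC k : measurable (C k : set (borel S)).
  by apply: measurableC; exact: bigsetU_measurable.
apply: le_trans (epsilon_trick0 xpredT (ltW e0)).
apply: (@le_trans _ _ (\sum_(0 <= k <oo) phi (C k))%E).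
  apply: (measure_sigma_subadditive phi mC) => //.
  by apply: bigcup_measurable => k _; exact: mC.
apply: lee_nneseries => [k _ _|k _] //; exact: NP.
Qed.

(** * Tightness and order boundedness *)

Section OrderedPolishSpaces.
Context (R : realType) (d : Order.disp_t) (S : POrderedPointedTopological.type d).
Hypothesis polishS : partially_ordered_polish R S.
Hypothesis compactS : forall K : set S,
  compact K <-> closed K /\ order_bounded (fun x y : S => (x <= y)%O) K.

(** Closedness may be tested on sequences since the space is metrizable, and
    constant sequences reduce it to the closedness of the order. *)
Lemma closed_ge (a : S) : closed [set x | (a <= x)%O].
Proof.
have [_ [dist [_ metS _]] ordS] := polishS.
apply: (seq_closed_closed _ _ _ metS) => u x au ux.
by apply: (ordS (fun=> a) u) => //; exact: cvg_cst.
Qed.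

Lemma closed_le (b : S) : closed [set x | (x <= b)%O].
Proof.
have [_ [dist [_ metS _]] ordS] := polishS.
apply: (seq_closed_closed _ _ _ metS) => u x ub ux.
by apply: (ordS u (fun=> b)) => //; exact: cvg_cst.
Qed.

(** An interval with [a <= b] is closed and bounded by its own endpoints; when
    [a <= b] fails it is empty, by transitivity. *)
Lemma compact_order_interval (a b : S) :
  compact (order_interval (fun x y : S => (x <= y)%O) a b).
Proof.
have [ab|nab] := boolP (a <= b)%O.
  apply/compactS; split; last by exists a, b; split.
  exact: closedI (closed_ge a) (closed_le b).
rewrite (_ : order_interval _ a b = set0); first exact: compact0.
by apply/seteqP; split=> // x [ax xb]; rewrite (le_trans ax xb) in nab.
Qed.

(** Finite sets are compact, so the hypothesis on compact sets makes the order
    directed, both upwards and downwards. *)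
Lemma finite_order_bounded (A : set S) : finite_set A ->
  exists a b : S, A `<=` order_interval (fun x y : S => (x <= y)%O) a b.
Proof.
by move=> /finite_compact /compactS [_ [a [b [_ Aab]]]]; exists a, b.
Qed.

(** Bounds of the single sets [K n] need not be comparable with each other;
    directedness allows them to be replaced recursively by monotone ones, as
    [geom_mix_dominates] requires. *)
Lemma exhausting_intervals (K : nat -> set S) : (forall n, compact (K n)) ->
  exists a b : nat -> S, forall n,
    [/\ (a n.+1 <= a n)%O, (b n <= b n.+1)%O, (a n <= b n)%O &
        K n `<=` order_interval (fun x y : S => (x <= y)%O) (a n) (b n)].
Proof.
move=> cK.
have /choice [k kK] (n : nat) : exists p : S * S, (p.1 <= p.2)%O /\
    K n `<=` order_interval (fun x y : S => (x <= y)%O) p.1 p.2.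
  by have /compactS [_ [a [b [ab Kab]]]] := cK n; exists (a, b).
have /choice [j jP] (pq : (S * S) * (S * S)) : exists r : S * S,
    [set pq.1.1; pq.1.2; pq.2.1; pq.2.2] `<=`
    order_interval (fun x y : S => (x <= y)%O) r.1 r.2.
  have [|a [b ab]] := @finite_order_bounded
      [set pq.1.1; pq.1.2; pq.2.1; pq.2.2].
    by rewrite !finite_setU.
  by exists (a, b).
(* The [n.+1]st interval bounds the four endpoints of the previous interval and
   of an interval around [K n.+1]. *)
pose r := fix r n := if n is m.+1 then j (r m, k m.+1) else k 0%N.
exists (fun n => (r n).1), (fun n => (r n).2) => n.
have rS m : [/\ ((r m.+1).1 <= (r m).1)%O, ((r m).2 <= (r m.+1).2)%O,
    ((r m.+1).1 <= (k m.+1).1)%O & ((k m.+1).2 <= (r m.+1).2)%O].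
  have rP := jP (r m, k m.+1); split.
  - by have [|] := rP (r m).1; first by left; left; left.
  - by have [|] := rP (r m).2; first by left; left; right.
  - by have [|] := rP (k m.+1).1; first by left; right.
  - by have [|] := rP (k m.+1).2; first by right.
have rk m : ((r m).1 <= (k m).1)%O /\ ((k m).2 <= (r m).2)%O.
  by case: m => [//|m]; have [] := rS m.
have [ka kb] := rk n; have [kab Kk] := kK n; have [ra rb _ _] := rS n.
split=> // [|x /Kk [kx xk]].
  by rewrite (le_trans ka)// (le_trans kab).
by split; [rewrite (le_trans ka)|rewrite (le_trans xk)].
Qed.

Lemma order_bounded_tight (L : set (probability (borel S) R)) :
  order_bounded (@sd_le R d S) L -> tight L.
Proof.
move=> [mu [nu [_ Lmunu]]] e e0.
have [sepS metrS _] := polishS.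
have tightS (phi : probability (borel S) R) := ulam _ _ phi sepS metrS.
have [K1 cK1 muK1] := tightS mu (e / 2) (divr_gt0 e0 (ltr0Sn R 1)).
have [K2 cK2 nuK2] := tightS nu (e / 2) (divr_gt0 e0 (ltr0Sn R 1)).
have [clK1 [a [a' [_ aK1]]]] := (compactS K1).1 cK1.
have [clK2 [b' [b [_ bK2]]]] := (compactS K2).1 cK2.
exists (order_interval (fun x y : S => (x <= y)%O) a b).
  exact: compact_order_interval.
move=> phi /Lmunu [/sd_le_upset muphi /sd_le_upset phinu].
pose A : set (borel S) := [set x : S | (a <= x)%O].
pose B : set (borel S) := ~` [set x : S | (x <= b)%O].
have mA : measurable A by apply: closed_borel; exact: closed_ge.
have mB : measurable B.
  by apply: measurableC; apply: closed_borel; exact: closed_le.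
(* [A] itself is the up-set, so [phi] has at least the [mu]-measure on it. *)
have phiA : (phi (~` A) <= (e / 2)%:E)%E.
  apply: le_trans (muK1 mu erefl).
  apply: (@le_trans _ _ (mu (~` A))).
    rewrite le_probability_setC// muphi// => x y xy ax.
    exact: le_trans xy.
  apply: le_measure; rewrite ?inE; [exact: measurableC| |].
    by apply: measurableC; exact: closed_borel.
  by apply: subsetC => x /aK1 [].
have phiB : (phi B <= (e / 2)%:E)%E.
  apply: le_trans (nuK2 nu erefl).
  apply: (@le_trans _ _ (nu B)).
    by apply: phinu => // x y xy nxb yb; apply: nxb; exact: le_trans yb.
  apply: le_measure; rewrite ?inE//.
    by apply: measurableC; exact: closed_borel.
  by apply: subsetC => x /bK2 [].
rewrite (_ : ~` _ = ~` A `|` B); last by rewrite -setCI.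
rewrite (splitr e) EFinD (le_trans (measureU2 _ _ _))//.
  exact: measurableC.
exact: leeD.
Qed.

Lemma tight_order_bounded (L : set (probability (borel S) R)) :
  tight L -> order_bounded (@sd_le R d S) L.
Proof.
move=> tL.
have /choice [K KP] (n : nat) : exists K : set S, compact K /\
    forall phi, L phi -> (phi (~` K) <= (2 ^- n.+1)%:E)%E.
  have [|K cK LK] := tL (2 ^- n.+1); last by exists K.
  by rewrite invr_gt0 exprn_gt0.
have [a [b abP]] := @exhausting_intervals K (fun n => (KP n).1).
pose mu : probability (borel S) R := @geom_mix R _ (borel S) a.
pose nu : probability (borel S) R := @geom_mix R _ (borel S) b.
exists mu, nu.
have mK n : measurable (K n : set (borel S)).
  by apply: closed_borel; have [/compactS []] := KP n.
split.
  apply/sd_le_upset => U mU upU.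
  rewrite /mu /nu /= !geom_mixE.
  apply: lee_nneseries => [n _ _|n _]; rewrite lee_fin ?mulr_ge0//.
  rewrite ler_wpM2l// ler_nat.
  case: (boolP (a n \in U)) => //; rewrite inE => Uan.
  by rewrite mem_set//; apply: upU Uan; have [] := abP n.
move=> phi Lphi; split; apply/sd_le_upset => U mU upU.
  rewrite -le_probability_setC//.
  apply: (@geom_mix_dominates R _ (borel S) a phi (~` U) K) => //.
  - exact: measurableC.
  - by move=> n; have [_] := KP n; exact.
  - move=> n /contrapT Uan x nUx Kx; apply: nUx.
    by apply: upU Uan; have [_ _ _ /(_ _ Kx) []] := abP n.
  - move=> n nU U'; apply: nU; apply: upU U'.
    by have [] := abP n.
apply: (@geom_mix_dominates R _ (borel S) b phi U K) => //.
- by move=> n; have [_] := KP n; exact.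
- move=> n nU x Ux Kx; apply: nU.
  by apply: upU Ux; have [_ _ _ /(_ _ Kx) []] := abP n.
- by move=> n; apply: upU; have [] := abP n.
Qed.

End OrderedPolishSpaces.

Theorem proposition3p1 (R : realType) (d : Order.disp_t)
    (S : POrderedPointedTopological.type d)
    (polishS : partially_ordered_polish R S)
    (compactS : forall K : set S,
       compact K <-> closed K /\ order_bounded (fun x y : S => (x <= y)%O) K)
    (L : set (probability (borel S) R)) :
  tight L <-> order_bounded (@sd_le R d S) L.
Proof.
split; [exact: tight_order_bounded|exact: order_bounded_tight].
Qed.
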